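(* Let $\Phi$ be a positive linear map and $B\succeq 0$ a fixed $d\times d$ symmetric positive semidefinite matrix, such that $\phi(X):=\Phi(X)+B$ defines a map $\phi:\mathbb{P}_d\to\mathbb{P}_d$. Let $f:\mathbb{P}_d\to\mathbb{P}_m$ be continuous, g-convex and monotonically increasing, i.e. $f(X)\preceq f(Y)$ whenever $X\preceq Y$. Then the function $g(X):=f(\phi(X))$ is g-convex on $\mathbb{P}_d$.
   Context: $\mathbb{P}_d$ is the set of $d\times d$ real symmetric positive definite matrices, equipped with the affine-invariant Riemannian metric $\langle U,V\rangle_X=\operatorname{tr}(X^{-1}UX^{-1}V)$; the unique geodesic from $A$ to $B$ is $A\sharp_t B=A^{1/2}(A^{-1/2}BA^{-1/2})^tA^{1/2}$, $t\in[0,1]$. $\preceq$ is the Löwner order: $A\preceq B$ iff $B-A$ is symmetric positive semidefinite. A matrix-valued function $f:\mathbb{P}_d\to\mathbb{P}_m$ is g-convex if $f(A\sharp_t B)\preceq(1-t)f(A)+tf(B)$ for all $A,B\in\mathbb{P}_d$, $t\in[0,1]$. A positive linear map $\Phi$ is a linear map on $d\times d$ matrices with $\Phi(X)\succeq0$ whenever $X\succeq0$. *)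

(* Defs.v *)
From mathcomp Require Import all_boot all_order all_algebra.
From mathcomp Require Import all_classical all_reals all_analysis.

Set Implicit Arguments.
Unset Strict Implicit.
Unset Printing Implicit Defensive.

Import Order.TTheory GRing.Theory Num.Theory.
Import numFieldNormedType.Exports.

Local Open Scope classical_set_scope.
Local Open Scope ring_scope.

Definition psdmx (R : realType) (n : nat) : set 'M[R]_n :=
  [set X | X \is symmetricmx /\
           forall v : 'cV[R]_n, 0 <= (v^T *m X *m v) ord0 ord0].

Definition pdmx (R : realType) (n : nat) : set 'M[R]_n :=
  [set X | X \is symmetricmx /\
           forall v : 'cV[R]_n, v != 0 -> 0 < (v^T *m X *m v) ord0 ord0].

Definition loewner_le (R : realType) (n : nat) (X Y : 'M[R]_n) : Prop :=
  psdmx (Y - X).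

Definition eigendec (R : realType) (n : nat) (X : 'M[R]_n) :
    set ('M[R]_n * 'rV[R]_n) :=
  [set Pl | Pl.1 *m Pl.1^T = 1%:M /\ X = Pl.1 *m diag_mx Pl.2 *m Pl.1^T].

(* X^t by functional calculus, X^t = P diag(l_i^t) P^T, where P orthogonal and
   X = P diag(l) P^T are chosen arbitrarily: the value does not depend on the
   choice (mxpow_eigendec). It is a junk value if X has no such decomposition,
   i.e., if X is not symmetric. *)
Definition mxpow (R : realType) (n : nat) (X : 'M[R]_n) (t : R) : 'M[R]_n :=
  let: (P, l) := xget (1%:M, 0) (eigendec X) in
  P *m diag_mx (map_mx (fun x => x `^ t) l) *m P^T.

Lemma mxpow_eigendec (R : realType) (n : nat) (X P : 'M[R]_n) (l : 'rV[R]_n)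
    (t : R) :
  P *m P^T = 1%:M -> X = P *m diag_mx l *m P^T ->
  mxpow X t = P *m diag_mx (map_mx (fun x => x `^ t) l) *m P^T.
Proof.
move=> PP XE; rewrite /mxpow.
have : eigendec X (xget (1%:M, 0) (eigendec X)).
  by apply: (@xgetPex _ _ (eigendec X)); exists (P, l).
case: (xget _ _) => Q e [/= QQ XQ].
have PP' : P^T *m P = 1%:M by exact: mulmx1C.
have QQ' : Q^T *m Q = 1%:M by exact: mulmx1C.
pose W := Q^T *m P.
have WE : W *m diag_mx l = diag_mx e *m W.
  have : Q^T *m X *m P = Q^T *m X *m P by [].
  rewrite {1}XE XQ -!mulmxA PP' mulmx1 !mulmxA QQ' mul1mx -mulmxA => ->.
  by rewrite -mulmxA.
have WtE : W *m diag_mx (map_mx (fun x => x `^ t) l) =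
           diag_mx (map_mx (fun x => x `^ t) e) *m W.
  apply/matrixP => i j; move/matrixP: WE => /(_ i j).
  rewrite !mul_mx_diag !mul_diag_mx !mxE.
  set w := (\sum_k _); have [->|w0] := eqVneq w 0; first by rewrite !(mul0r, mulr0).
  by rewrite mulrC => /(mulIf w0) ->; rewrite mulrC.
have -> : P *m diag_mx (map_mx (fun x => x `^ t) l) =
          Q *m (W *m diag_mx (map_mx (fun x => x `^ t) l)).
  by rewrite !mulmxA QQ mul1mx.
by rewrite WtE -!mulmxA PP mulmx1.
Qed.

(* The point at time t of the geodesic from A to B. *)
Definition geomean (R : realType) (n : nat) (A B : 'M[R]_n) (t : R) : 'M[R]_n :=
  mxpow A 2^-1 *m
    mxpow (mxpow A (- 2^-1) *m B *m mxpow A (- 2^-1)) t *m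
  mxpow A 2^-1.

(* Geodesic convexity on the positive definite cone; the values of f elsewhere
   are irrelevant. *)
Definition gconvex (R : realType) (d m : nat) (f : 'M[R]_d -> 'M[R]_m) : Prop :=
  forall (A B : 'M[R]_d) (t : R), pdmx A -> pdmx B -> 0 <= t <= 1 ->
    loewner_le (f (geomean A B t)) ((1 - t) *: f A + t *: f B).

Definition loewner_increasing (R : realType) (d m : nat)
    (f : 'M[R]_d -> 'M[R]_m) : Prop :=
  forall X Y : 'M[R]_d, pdmx X -> pdmx Y ->
    loewner_le X Y -> loewner_le (f X) (f Y).

Definition positive_map (R : realType) (d : nat)
    (Phi : {linear 'M[R]_d -> 'M[R]_d}) : Prop :=
  forall X : 'M[R]_d, psdmx X -> psdmx (Phi X).

(* Main.v *)
(* Diagonalising [A^(-1/2) B A^(-1/2)] yields positive semidefinite [Q_i] and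
   [lam_i > 0] with [A = \sum_i Q_i], [B = \sum_i lam_i Q_i] and
   [A #_t B = \sum_i lam_i^t Q_i].  An affine positive map preserves sums of this
   shape (its constant term enters with weight 1), so that
   [phi (A #_t B) <= phi A #_t phi B], the instance of monotonicity that is
   needed, reduces to [\sum_i lam_i^t Q_i <= (\sum_i Q_i) #_t (\sum_i lam_i Q_i)].
   After normalising [\sum_i Q_i = 1], the set of exponents [t] for which this
   holds is closed, contains 0 and 1, and is stable under midpoints. *)
Require Import Defs.
From mathcomp Require Import all_boot all_order all_algebra.
From mathcomp Require Import all_classical all_reals all_analysis.
From mathcomp Require Import complex ring lra.

Set Implicit Arguments.
Unset Strict Implicit.
Unset Printing Implicit Defensive.

Import Order.TTheory GRing.Theory Num.Theory.
Import numFieldNormedType.Exports.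

Local Open Scope classical_set_scope.
Local Open Scope ring_scope.

(** * Orthogonal diagonalisation of real symmetric matrices *)

Section SpectralTheorem.
Local Open Scope sesquilinear_scope.
Local Open Scope complex_scope.
Variable R : rcfType.

Lemma mx11_tr (S : comNzRingType) (X : 'M[S]_1) : X^T = X.
Proof. by rewrite [X]mx11_scalar tr_scalar_mx. Qed.

Lemma symmetricmxP n (A : 'M[R]_n) : reflect (A^T = A) (A \is symmetricmx).
Proof.
apply: (iffP (is_hermitianmxP _ _ _)); rewrite expr0 scale1r map_mx_id // => /esym.
Qed.

(** The complexified matrix has an eigenvalue [a], with row eigenvector [v]. It is Hermitian, so
    computing [v A v^*] in two ways gives [a = a^*]; the real [a] is then a root of the
    characteristic polynomial over [R]. *)
Lemma symmetricmx_eigenvalue n (A : 'M[R]_n) :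
  (0 < n)%N -> A \is symmetricmx -> exists a, eigenvalue A a.
Proof.
move=> n_gt0 /symmetricmxP Asym.
pose toC := real_complex R.
have [a aA] := eigenvalue_closed (map_mx toC A) n_gt0.
have /eigenvalueP[v vA v0] := aA.
have a_real : a \is Num.real.
  apply/CrealP.
  have Ah : (map_mx toC A)^t* = map_mx toC A.
    apply/matrixP => i j; rewrite !mxE -{2}Asym mxE.
    by apply/CrealP/complex_realP; exists (A j i).
  have vA' : map_mx toC A *m v^t* = a^* *: v^t*.
    have /(congr1 (fun M => M^t*)) := vA.
    by rewrite trmx_mul map_mxM Ah linearZ /= map_mxZ.
  have : v *m (map_mx toC A *m v^t*) = v *m map_mx toC A *m v^t*.
    by rewrite mulmxA.
  rewrite vA vA' -scalemxAl -scalemxAr => /matrixP /(_ 0 0).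
  rewrite [LHS]mxE [RHS]mxE -dotmxE => /mulIf; apply.
  by rewrite dnorm_eq0.
have [b ab] : exists b, a = toC b by exact/complex_realP.
exists b; rewrite eigenvalue_root_char -(fmorph_root toC).
by rewrite map_char_poly /= -/toC -ab -eigenvalue_root_char.
Qed.

Lemma row_norm_gt0 n (v : 'rV[R]_n) : v != 0 -> 0 < (v *m v^T) 0 0.
Proof.
move=> v0; have [j vj] : exists j, v 0 j != 0.
  apply/existsP; apply: contraNT v0 => /existsPn v0; apply/eqP/rowP => j.
  by rewrite mxE; apply/eqP; have := v0 j; rewrite negbK.
rewrite mxE (bigD1 j) //= mxE ltr_wpDr //.
  by apply: sumr_ge0 => i _; rewrite mxE -expr2 sqr_ge0.
by rewrite -expr2 exprn_even_gt0.
Qed.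

(** The reflection along [w = v - e] exchanges two distinct unit vectors; for [e = v] the identity
    serves. *)
Lemma householder n (e v : 'rV[R]_n) :
  e *m e^T = 1%:M -> v *m v^T = 1%:M ->
  exists2 H : 'M[R]_n, H *m H^T = 1%:M & e *m H = v.
Proof.
move=> ee vv; have [<-|ve] := eqVneq e v.
  by exists 1%:M; rewrite ?mulmx1 // trmx1 mulmx1.
pose w := v - e; pose c := (w *m w^T) 0 0.
have c0 : c != 0.
  by rewrite gt_eqF // row_norm_gt0 // subr_eq0 eq_sym.
have wwE : w *m w^T = c%:M by rewrite [LHS]mx11_scalar.
have evE : v *m e^T = e *m v^T by rewrite -[LHS]mx11_tr trmx_mul trmxK.
(* Since [c = 2 - 2 (e v^T)] and [e w^T = e v^T - 1], subtracting [(2 / c) (e w^T) w] from [e] adds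
   exactly [w]. *)
have ewE : e *m w^T = (- (c / 2))%:M.
  rewrite /c /w linearB /= mulmxBl !mulmxBr vv ee evE [LHS]mx11_scalar.
  move: (e *m v^T) => x; rewrite !mxE /=; congr (_ %:M); lra.
have ewv : e + w = v by rewrite addrC subrK.
clearbody c w; exists (1%:M - (2 / c) *: (w^T *m w)).
  have -> : (1%:M - (2 / c) *: (w^T *m w))^T = 1%:M - (2 / c) *: (w^T *m w).
    by rewrite linearB linearZ /= trmx_mul trmxK trmx1.
  rewrite mulmxBl mul1mx mulmxBr mulmx1 -scalemxAl -scalemxAr.
  rewrite -mulmxA (mulmxA w) wwE mul_scalar_mx -scalemxAr !scalerA.
  rewrite -addrA -opprD -scalerBl (_ : 2 / c - 2 / c * (2 / c * c) = - (2/c)).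
    by rewrite scaleNr subrr subr0.
  by field.
rewrite mulmxBr mulmx1 -scalemxAr mulmxA ewE mul_scalar_mx scalerA.
rewrite (_ : _ * _ = -1) ?scaleN1r ?opprK //.
by field.
Qed.

(** Deflation: a Householder matrix taking the first basis vector to a unit eigenvector conjugates
    [A] to a block diagonal matrix, whose lower block is handled by induction. *)
Lemma symmetricmx_spectral n (A : 'M[R]_n) : A \is symmetricmx ->
  exists P : 'M[R]_n, exists l : 'rV[R]_n,
    P *m P^T = 1%:M /\ A = P *m diag_mx l *m P^T.
Proof.
elim: n A => [|n IH] A Asym.
  by exists 1%:M, 0; split; apply/matrixP => - [].
have [a /eigenvalueP[u uA u0]] := symmetricmx_eigenvalue (ltn0Sn n) Asym.
have u_gt0 := row_norm_gt0 u0.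
pose v := (Num.sqrt ((u *m u^T) 0 0))^-1 *: u.
have vv : v *m v^T = 1%:M.
  rewrite /v linearZ /= -scalemxAl -scalemxAr scalerA -invfM -expr2.
  rewrite sqr_sqrtr ?ltW // [u *m u^T]mx11_scalar scale_scalar_mx mxE /= mulVf //.
  by rewrite gt_eqF.
have vA : v *m A = a *: v by rewrite -scalemxAl uA scalerA mulrC -scalerA.
pose e : 'rV[R]_(1 + n) := row_mx 1%:M 0.
have ee : e *m e^T = 1%:M.
  by rewrite /e tr_row_mx mul_row_col trmx1 trmx0 !mulmx0 mulmx1 addr0.
have [H HH eH] := householder ee vv.
pose M : 'M[R]_(1 + n) := H *m A *m H^T.
have Msym : M^T = M.
  by rewrite /M !trmx_mul trmxK (symmetricmxP _ Asym) mulmxA.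
have eM : e *m M = a *: e.
  by rewrite /M !mulmxA eH vA -scalemxAl -{1}eH -mulmxA HH mulmx1.
(* [eM] fixes the first row of [M]; symmetry then clears the first column. *)
have ME : M = block_mx a%:M 0 0 (drsubmx M).
  move: eM; rewrite -{1}[M]submxK /e mul_row_block !mul1mx !mul0mx !addr0.
  rewrite scale_row_mx scaler0 => /eq_row_mx[ulE urE].
  have dlE : dlsubmx M = 0 by rewrite -[M]Msym -trmx_ursub urE trmx0.
  by rewrite -{1}[M]submxK ulE urE dlE scalemx1.
have [|Q [l [QQ QE]]] := IH (drsubmx M).
  by apply/symmetricmxP; rewrite trmx_drsub Msym.
pose P : 'M[R]_(1 + n) := block_mx 1%:M 0 0 Q.
pose k : 'rV[R]_(1 + n) := row_mx a%:M l.
have PP : P *m P^T = 1%:M.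
  rewrite /P tr_block_mx mulmx_block !(trmx1, trmx0, mulmx0, mul0mx, mulmx1).
  by rewrite !(addr0, add0r) QQ -scalar_mx_block.
have MP : M = P *m diag_mx k *m P^T.
  rewrite {1}ME /P /k diag_mx_row tr_block_mx !mulmx_block.
  rewrite !(trmx1, trmx0, mulmx0, mul0mx, mulmx1, addr0, add0r, mul1mx) -QE.
  by congr block_mx; rewrite [LHS]mx11_scalar [RHS]mx11_scalar !mxE.
have H'H : H^T *m H = 1%:M by exact: mulmx1C.
exists (H^T *m P), k; split.
  by rewrite trmx_mul trmxK mulmxA -(mulmxA H^T) PP mulmx1.
have : H^T *m M *m H = A.
  by rewrite /M !mulmxA H'H mul1mx -mulmxA H'H mulmx1.
by rewrite trmx_mul trmxK MP !mulmxA => <-.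
Qed.

End SpectralTheorem.

(** * Quadratic forms, congruence and the Löwner order *)

Section LoewnerOrder.
Variables (R : realType) (n : nat).
Implicit Types (X Y S P : 'M[R]_n) (u v : 'cV[R]_n) (l : 'rV[R]_n).

Lemma form_diag l v :
  (v^T *m diag_mx l *m v) 0 0 = \sum_i l 0 i * v i 0 ^+ 2.
Proof.
rewrite mxE; apply: eq_bigr => i _.
by rewrite mul_mx_diag !mxE; ring.
Qed.

Lemma form_congr X S v :
  v^T *m (S^T *m X *m S) *m v = (S *m v)^T *m X *m (S *m v).
Proof. by rewrite trmx_mul !mulmxA. Qed.

Lemma symmetricmx_congr X S :
  X \is symmetricmx -> S^T *m X *m S \is symmetricmx.
Proof.
move=> /symmetricmxP XE; apply/symmetricmxP.
by rewrite !trmx_mul trmxK XE mulmxA.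
Qed.

Lemma psdmx_congr X S : psdmx X -> psdmx (S^T *m X *m S).
Proof.
move=> [Xsym Xge0]; split; first exact: symmetricmx_congr.
by move=> v; rewrite form_congr; apply: Xge0.
Qed.

Lemma pdmx_congr X S : S \in unitmx -> pdmx X -> pdmx (S^T *m X *m S).
Proof.
move=> Su [Xsym Xgt0]; split; first exact: symmetricmx_congr.
move=> v v0; rewrite form_congr; apply: Xgt0.
by apply: contra_neq v0 => Sv0; rewrite -(mulKmx Su v) Sv0 mulmx0.
Qed.

Lemma psdmxD X Y : psdmx X -> psdmx Y -> psdmx (X + Y).
Proof.
move=> [/symmetricmxP Xs X0] [/symmetricmxP Ys Y0]; split.
  by apply/symmetricmxP; rewrite linearD /= Xs Ys.
by move=> v; rewrite mulmxDr mulmxDl mxE addr_ge0.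
Qed.

Lemma loewner_le_trans X Y Z :
  loewner_le X Y -> loewner_le Y Z -> loewner_le X Z.
Proof.
by move=> XY YZ; have := psdmxD YZ XY; rewrite addrA subrK.
Qed.

Lemma psdmx0 : psdmx (0 : 'M[R]_n).
Proof.
split=> [|v]; first by apply/symmetricmxP; rewrite trmx0.
by rewrite mulmx0 mul0mx mxE.
Qed.

Lemma psdmx_diag l : (forall i, 0 <= l 0 i) -> psdmx (diag_mx l).
Proof.
move=> l_ge0; split; first by apply/symmetricmxP; rewrite tr_diag_mx.
move=> v; rewrite form_diag; apply: sumr_ge0 => i _.
by rewrite mulr_ge0 ?sqr_ge0.
Qed.

Lemma pdmx_diag l : (forall i, 0 < l 0 i) -> pdmx (diag_mx l).
Proof.
move=> l_gt0; split; first by apply/symmetricmxP; rewrite tr_diag_mx.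
move=> v v0; have [j vj] : exists j, v j 0 != 0.
  apply/existsP; apply: contraNT v0 => /existsPn v0; apply/eqP/colP => j.
  by rewrite mxE; apply/eqP; have := v0 j; rewrite negbK.
rewrite form_diag (bigD1 j) //= ltr_pwDl //.
  by rewrite mulr_gt0 // exprn_even_gt0.
by apply: sumr_ge0 => i _; rewrite mulr_ge0 ?sqr_ge0 ?ltW.
Qed.

Lemma pdmx_spectral X : pdmx X -> exists P l,
  [/\ P *m P^T = 1%:M, X = P *m diag_mx l *m P^T & forall i, 0 < l 0 i].
Proof.
move=> [Xsym Xgt0]; have [P [l [PP XE]]] := symmetricmx_spectral Xsym.
exists P, l; split => // i.
have P'P : P^T *m P = 1%:M by exact: mulmx1C.
have PXP : P^T *m X *m P = diag_mx l.
  by rewrite XE !mulmxA P'P mul1mx -mulmxA P'P mulmx1.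
(* At the [i]-th column of [P] the form takes the value [l 0 i]; this column is nonzero because
   [P^T] sends it to a basis vector. *)
have := Xgt0 (P *m delta_mx i 0).
rewrite -form_congr PXP form_diag (bigD1 i) //= big1.
  rewrite !mxE !eqxx expr1n mulr1 addr0; apply.
  apply/eqP => /(congr1 (fun u => (P^T *m u) i 0)).
  rewrite mulmxA P'P mul1mx mulmx0 !mxE !eqxx => /eqP.
  by rewrite oner_eq0.
by move=> j ji; rewrite !mxE (negPf ji) expr0n mulr0.
Qed.

End LoewnerOrder.

(** * Real powers of a positive definite matrix *)

Section Powers.
Variables (R : realType) (n : nat) (X : 'M[R]_n).
Hypothesis X_pd : pdmx X.
Implicit Types (s t : R).

Lemma mxpowD s t : mxpow X (s + t) = mxpow X s *m mxpow X t.
Proof.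
have [P [l [PP XE l_gt0]]] := pdmx_spectral X_pd.
rewrite !(mxpow_eigendec _ PP XE) !mulmxA.
rewrite -[in RHS](mulmxA _ P^T) (mulmx1C PP) mulmx1 -[in RHS](mulmxA P) mulmx_diag.
congr (P *m diag_mx _ *m _); apply/rowP => i; rewrite !mxE powRD //.
by rewrite (gt_eqF (l_gt0 i)) implybT.
Qed.

Lemma mxpow0 : mxpow X 0 = 1%:M.
Proof.
have [P [l [PP XE l_gt0]]] := pdmx_spectral X_pd.
rewrite (mxpow_eigendec _ PP XE) (_ : map_mx _ _ = const_mx 1).
  by rewrite diag_const_mx mulmx1.
by apply/rowP => i; rewrite !mxE powRr0.
Qed.

Lemma mxpow1 : mxpow X 1 = X.
Proof.
have [P [l [PP XE l_gt0]]] := pdmx_spectral X_pd.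
rewrite (mxpow_eigendec _ PP XE) [RHS]XE; congr (_ *m diag_mx _ *m _).
by apply/rowP => i; rewrite !mxE powRr1 // ltW.
Qed.

Lemma mxpow_unit s : mxpow X s \in unitmx.
Proof.
have sNs : mxpow X s *m mxpow X (- s) = 1%:M by rewrite -mxpowD subrr mxpow0.
exact: (mulmx1_unit sNs).1.
Qed.

Lemma pdmx_mxpow s : pdmx (mxpow X s).
Proof.
have [P [l [PP XE l_gt0]]] := pdmx_spectral X_pd.
rewrite (mxpow_eigendec _ PP XE) -{1}[P]trmxK; apply: pdmx_congr.
  by rewrite unitmx_tr; have [] := mulmx1_unit PP.
by apply: pdmx_diag => i; rewrite mxE powR_gt0.
Qed.

Lemma mxpow_tr s : (mxpow X s)^T = mxpow X s.
Proof. by apply/symmetricmxP; case: (pdmx_mxpow s). Qed.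

(** Congruence by a power only shifts the exponent, which lets [cross_form_le] bring different
    powers of [D] to a common one. *)
Lemma mxpow_congr s t :
  (mxpow X s)^T *m mxpow X t *m mxpow X s = mxpow X (2 * s + t).
Proof. by rewrite mxpow_tr -mxpowD -mxpowD addrC addrA mulr_natl mulr2n. Qed.

End Powers.

(** * The power inequality when the weights sum to the identity *)

Section OperatorConcavity.
Variables (R : realType) (n : nat).
Implicit Types (D W E : 'M[R]_n) (u v : 'cV[R]_n).

(* Conjugating by [D ^ (- r / 2)], [r = (s + t) / 2], the claim is that the
   eigenvalues [mu] of [K = D ^ (- r / 2) W D ^ (- r / 2)] are at most 1; for an
   eigenvector [p], the two vectors below turn the hypothesis into
   [2 mu q <= q + q] with [q = p^T D ^ ((t - s) / 2) p]. *)
Lemma cross_form_le D W s t : pdmx D -> W \is symmetricmx ->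
  (forall u v, 2 * (u^T *m W *m v) 0 0 <=
     (u^T *m mxpow D s *m u) 0 0 + (v^T *m mxpow D t *m v) 0 0) ->
  loewner_le W (mxpow D ((s + t) / 2)).
Proof.
move=> D_pd W_sym Wle.
(* [a] solves [2 a + s = 2 b + t]; the common value [(t - s) / 2] also equals [a - b], so all three
   forms below reduce to the same [q]. *)
pose r := (s + t) / 2; pose b := - (r / 2); pose a := (t - 3 * s) / 4.
have asE : 2 * a + s = a - b by rewrite /a /b /r; field.
have btE : 2 * b + t = a - b by rewrite /a /b /r; field.
have brE : b = - (r / 2) by [].
rewrite -/r; clearbody b a r.
pose K := mxpow D b *m W *m mxpow D b.
have [|P [mu [PP KE]]] := @symmetricmx_spectral _ _ K.
  by rewrite /K -{1}(mxpow_tr D_pd b); apply: symmetricmx_congr.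
have P'P : P^T *m P = 1%:M by exact: mulmx1C.
have mu_le1 i : mu 0 i <= 1.
  pose p : 'cV[R]_n := P *m delta_mx i 0.
  have p0 : p != 0.
    apply/eqP => /(congr1 (fun u => (P^T *m u) i 0)).
    rewrite mulmxA P'P mul1mx mulmx0 !mxE !eqxx => /eqP.
    by rewrite oner_eq0.
  have Kp : K *m p = mu 0 i *: p.
    rewrite KE /p -!mulmxA (mulmxA P^T) P'P mul1mx scalemxAr; congr (_ *m _).
    apply/colP => j; rewrite mul_diag_mx !mxE.
    by have [->|_] := eqVneq j i; rewrite ?mulr0.
  clearbody p; pose q := (p^T *m mxpow D (a - b) *m p) 0 0.
  have q_gt0 : 0 < q by have [_] := pdmx_mxpow D_pd (a - b); apply.
  have := Wle (mxpow D a *m p) (mxpow D b *m p).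
  rewrite -(form_congr (mxpow D s)) -(form_congr (mxpow D t)).
  rewrite !(mxpow_congr D_pd) asE btE.
  (* Splitting [D ^ a] as [D ^ (a - b) D ^ b] makes [K] appear, and [K] acts on [p] as the scalar
     [mu 0 i]. *)
  have -> : (mxpow D a *m p)^T *m W *m (mxpow D b *m p) =
            mu 0 i *: (p^T *m mxpow D (a - b) *m p).
    rewrite scalemxAr -Kp trmx_mul (mxpow_tr D_pd) /K.
    have -> : mxpow D a = mxpow D (a - b) *m mxpow D b.
      by rewrite -mxpowD ?subrK.
    by rewrite !mulmxA.
  rewrite [X in 2 * X]mxE -/q => muq.
  clearbody q; rewrite -(ler_pM2r q_gt0) mul1r. lra.
have DK : mxpow D r - W =
    (mxpow D (r / 2))^T *m (1%:M - K) *m mxpow D (r / 2).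
  rewrite (mxpow_tr D_pd) mulmxBr mulmx1 mulmxBl /K !mulmxA -!(mxpowD D_pd).
  rewrite -!mulmxA -!(mxpowD D_pd) brE subrr addNr (mxpow0 D_pd) mulmx1 mul1mx.
  by rewrite -splitr.
rewrite /loewner_le DK; apply: psdmx_congr.
have -> : 1%:M - K = P^T^T *m diag_mx (\row_i (1 - mu 0 i)) *m P^T.
  rewrite trmxK KE -{1}PP -{1}[P]mulmx1 -mulmxBl -mulmxBr.
  congr (_ *m _ *m _); apply/matrixP => i j.
  by rewrite !mxE; case: eqP => //= _; rewrite subr0.
by apply/psdmx_congr/psdmx_diag => i; rewrite mxE subr_ge0.
Qed.

(** Expand the nonnegative form of [E] at [x ^ (s / 2) u - x ^ (t / 2) v]. *)
Lemma psdmx_young E u v (x s t : R) : psdmx E -> 0 < x ->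
  2 * (x `^ ((s + t) / 2) * (u^T *m E *m v) 0 0) <=
    x `^ s * (u^T *m E *m u) 0 0 + x `^ t * (v^T *m E *m v) 0 0.
Proof.
move=> [/symmetricmxP E_sym E_ge0] x_gt0.
have x0 : x != 0 by rewrite gt_eqF.
pose a := x `^ (s / 2); pose b := x `^ (t / 2).
have aa : x `^ s = a ^+ 2 by rewrite expr2 -powRD ?x0 ?implybT // -splitr.
have bb : x `^ t = b ^+ 2 by rewrite expr2 -powRD ?x0 ?implybT // -splitr.
have ab : x `^ ((s + t) / 2) = a * b by rewrite mulrDl powRD ?x0 ?implybT.
have := E_ge0 (a *: u - b *: v).
have vu : v^T *m E *m u = u^T *m E *m v.
  by rewrite -[LHS]mx11_tr !trmx_mul trmxK E_sym mulmxA.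
have -> : (a *: u - b *: v)^T = a *: u^T - b *: v^T.
  by rewrite linearB !linearZ.
rewrite mulmxBr !mulmxBl -!scalemxAr -!scalemxAl.
rewrite vu aa bb ab.
move: (u^T *m E *m v) (u^T *m E *m u) (v^T *m E *m v) => e1 e2 e3.
by rewrite !mxE; nra.
Qed.

Lemma continuous_powR_sum (I : finType) (a c : I -> R) :
  (forall i, 0 < a i) -> continuous (fun t : R => \sum_i a i `^ t * c i).
Proof.
move=> a_gt0; apply: continuous_big => [|i _].
  exact: add_continuous.
move=> t; apply: cvgM; last exact: cvg_cst.
(* A positive base selects the branch of [powR] given by [expR (t * ln (a i))]. *)
rewrite /powR gt_eqF //.
apply: continuous_comp; last exact: continuous_expR.
by apply: cvgM; [exact: cvg_id | exact: cvg_cst].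
Qed.

(** Bisection keeps [t] between two points of [S] at distance [2 ^ (- k)], so [t] lies in the
    closure of [S]. *)
Lemma midpoint_closed_segment (S : set R) : closed S -> S 0 -> S 1 ->
  (forall s t, S s -> S t -> S ((s + t) / 2)) ->
  forall t, 0 <= t <= 1 -> S t.
Proof.
move=> S_closed S0 S1 S_mid t /andP[t0 t1].
have bisect k : exists a b, [/\ S a, S b, a <= t <= b & b - a = 2^-1 ^+ k].
  elim: k => [|k [a [b [Sa Sb /andP[at_ tb] ab]]]].
    by exists 0, 1; rewrite t0 t1 subr0 expr0.
  have Sm := S_mid _ _ Sa Sb.
  have [tm|mt] := leP t ((a + b) / 2).
    by exists a, ((a + b) / 2); rewrite at_ tm exprS -ab; split => //; field.
  by exists ((a + b) / 2), b; rewrite (ltW mt) tb exprS -ab; split => //; field.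
suff: closure S t by rewrite -((closure_id S).1 S_closed).
move=> U /nbhs_ballP[e /= e_gt0 eU].
have [N ke] : exists N, 2^-1 ^+ N < e.
  have [N _ Ne] := near_infty_natSinv_expn_lt (PosNum e_gt0).
  by exists N; rewrite exprVn -div1r; exact: (Ne N (leqnn N)).
have [a [b [Sa Sb /andP[at_ tb] ab]]] := bisect N.
exists a; split => //; apply: eU; rewrite /ball /= ger0_norm; lra.
Qed.

Lemma powR_sum_le (I : finType) (lam : I -> R) (E : I -> 'M[R]_n) (t : R) :
  (forall i, 0 < lam i) -> (forall i, psdmx (E i)) -> \sum_i E i = 1%:M ->
  pdmx (\sum_i lam i *: E i) -> 0 <= t <= 1 ->
  loewner_le (\sum_i lam i `^ t *: E i) (mxpow (\sum_i lam i *: E i) t).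
Proof.
move=> lam_gt0 E_psd E1; set D := \sum_i lam i *: E i => D_pd.
pose W s := \sum_i lam i `^ s *: E i.
have W_sym s : (W s)^T = W s.
  rewrite /W linear_sum; apply: eq_bigr => i _; rewrite linearZ /=.
  by have [/symmetricmxP ->] := E_psd i.
have W_form s u v :
    (u^T *m W s *m v) 0 0 = \sum_i lam i `^ s * (u^T *m E i *m v) 0 0.
  rewrite mulmx_sumr mulmx_suml summxE; apply: eq_bigr => i _.
  by rewrite -scalemxAr -scalemxAl mxE.
move: t; apply: (@midpoint_closed_segment [set s | loewner_le (W s) (mxpow D s)]).
- have [P [l [PP DE l_gt0]]] := pdmx_spectral D_pd.
  (* In the eigenbasis of [D], the form of [D ^ s - W s] at a fixed [v] is a combination of powers
     of fixed positive bases, hence continuous in [s]. The set of exponents is thus an intersection,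
     over [v], of closed sets. *)
  pose g v s := \sum_i l 0 i `^ s * ((P^T *m v) i 0) ^+ 2 -
              \sum_i lam i `^ s * (v^T *m E i *m v) 0 0.
  have gE v s : (v^T *m (mxpow D s - W s) *m v) 0 0 = g v s.
    rewrite mulmxBr mulmxBl mxE [X in _ + X]mxE W_form; congr (_ - _).
    rewrite (mxpow_eigendec _ PP DE) -{1}[P]trmxK form_congr form_diag.
    by apply: eq_bigr => i _; rewrite mxE.
  rewrite (_ : [set _ | _] = \bigcap_v [set s | 0 <= g v s]).
    apply: closed_bigI => v _.
    apply: (@closed_comp _ _ (g v) [set x | 0 <= x]); last exact: closed_ge.
    move=> s _; apply: continuousB; apply: continuous_powR_sum => //.
  apply/seteqP; split => [s [_ Wle] v _|s gs]; first by rewrite /= -gE.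
  split.
    by apply/symmetricmxP; rewrite linearB /= W_sym mxpow_tr.
  by move=> v; rewrite gE; exact: (gs v).
- rewrite /= /loewner_le mxpow0 // /W (eq_bigr E) ?E1 ?subrr.
    exact: psdmx0.
  by move=> i _; rewrite powRr0 scale1r.
- rewrite /= /loewner_le mxpow1 // (_ : W 1 = D) ?subrr; first exact: psdmx0.
  by apply: eq_bigr => i _; rewrite powRr1 // ltW.
(* Midpoints: [psdmx_young], summed over [i], bounds the cross form of [W ((s + t) / 2)] by the
   forms of [W s] and [W t], which [Ws] and [Wt] bound by those of [D ^ s] and [D ^ t]. *)
move=> s t /= Ws Wt; apply: cross_form_le => //; first exact/symmetricmxP.
move=> u v; rewrite W_form mulr_sumr.
apply: (@le_trans _ _ ((u^T *m W s *m u) 0 0 + (v^T *m W t *m v) 0 0)).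
  rewrite !W_form -big_split; apply: ler_sum => i _.
  exact: psdmx_young.
apply: lerD; rewrite -subr_ge0.
- have [_ /(_ u)] := Ws; rewrite mulmxBr mulmxBl mxE [X in _ + X]mxE //.
- have [_ /(_ v)] := Wt; rewrite mulmxBr mulmxBl mxE [X in _ + X]mxE //.
Qed.

End OperatorConcavity.

(** * Geodesics as weighted sums of positive semidefinite matrices *)

Section GeometricMean.
Variables (R : realType) (n : nat).
Implicit Types (A B : 'M[R]_n) (t : R).

Lemma mxpow_halfK A : pdmx A ->
  mxpow A 2^-1 *m mxpow A (- 2^-1) = 1%:M /\
  mxpow A (- 2^-1) *m mxpow A 2^-1 = 1%:M.
Proof.
by move=> A_pd; rewrite -!mxpowD // subrr addNr mxpow0.
Qed.

Lemma mxpow_half_sqr A : pdmx A -> mxpow A 2^-1 *m mxpow A 2^-1 = A.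
Proof.
by move=> A_pd; rewrite -mxpowD // -[2^-1]mul1r -splitr mxpow1.
Qed.

Lemma pdmx_sandwich A B t : pdmx A -> pdmx B ->
  pdmx (mxpow A t *m B *m mxpow A t).
Proof.
move=> A_pd B_pd; rewrite -{1}(mxpow_tr A_pd); apply: pdmx_congr => //.
exact: mxpow_unit.
Qed.

Lemma pdmx_geomean A B t : pdmx A -> pdmx B -> pdmx (geomean A B t).
Proof.
by move=> A_pd B_pd; apply/pdmx_sandwich/pdmx_mxpow/pdmx_sandwich.
Qed.

Lemma geomean_decomposition A B : pdmx A -> pdmx B ->
  exists (lam : 'I_n -> R) (Q : 'I_n -> 'M[R]_n),
    [/\ forall i, 0 < lam i, forall i, psdmx (Q i), A = \sum_i Q i,
        B = \sum_i lam i *: Q i &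
        forall t, geomean A B t = \sum_i lam i `^ t *: Q i].
Proof.
move=> A_pd B_pd; have [ST TS] := mxpow_halfK A_pd.
have [P [l [PP CE l_gt0]]] := pdmx_spectral (pdmx_sandwich (- 2^-1) A_pd B_pd).
pose S := mxpow A 2^-1.
(* The spectral projections of [A ^ (-1/2) B A ^ (-1/2)], carried back by congruence with
   [S = A ^ (1/2)]. In [QE], the coefficients [1], [l] and [l ^ t] yield [A], [B] and the geodesic
   point. *)
pose Q i := S *m P *m delta_mx i i *m P^T *m S.
have QE (c : 'I_n -> R) :
    S *m (P *m diag_mx (\row_i c i) *m P^T) *m S = \sum_i c i *: Q i.
  have -> : diag_mx (\row_i c i) = \sum_i c i *: delta_mx i i.
    by rewrite diag_mx_sum_delta; apply: eq_bigr => i _; rewrite mxE.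
  rewrite mulmx_sumr !mulmx_suml mulmx_sumr mulmx_suml; apply: eq_bigr => i _.
  by rewrite -scalemxAr -scalemxAl -scalemxAr -scalemxAl /Q !mulmxA.
exists (l 0), Q; split => //.
- move=> i.
  have deltaE : delta_mx i i = diag_mx (delta_mx 0 i) :> 'M[R]_n.
    by rewrite diag_mx_sum_delta (bigD1 i) //= big1 => [|j ji];
       rewrite mxE ?eqxx ?(negPf ji) ?scale1r ?addr0 ?scale0r.
  have -> : Q i = (P^T *m S)^T *m diag_mx (delta_mx 0 i) *m (P^T *m S).
    by rewrite trmx_mul trmxK (mxpow_tr A_pd) /Q deltaE !mulmxA.
  by apply/psdmx_congr/psdmx_diag => j; rewrite mxE ler0n.
- rewrite -{1}(mxpow_half_sqr A_pd) -/S (eq_bigr (fun i => 1 *: Q i)).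
    rewrite -QE (_ : \row_i 1 = const_mx 1); last by apply/rowP => i; rewrite !mxE.
    by rewrite diag_const_mx mulmx1 PP mulmx1.
  by move=> i _; rewrite scale1r.
- rewrite -QE (_ : \row_i l 0 i = l); last by apply/rowP => i; rewrite mxE.
  by rewrite -CE !mulmxA ST mul1mx -mulmxA TS mulmx1.
move=> t; rewrite -QE /geomean (mxpow_eigendec _ PP CE).
have -> // : \row_i l 0 i `^ t = map_mx (fun x => x `^ t) l.
by apply/rowP => i; rewrite !mxE.
Qed.

(** Congruence by [M ^ (-1/2)], where [M] is the sum of the [Q i], reduces to [powR_sum_le];
    congruence by [M ^ (1/2)] transports the result back. *)
Lemma powR_sum_le_geomean (I : finType) (lam : I -> R) (Q : I -> 'M[R]_n) t :
  (forall i, 0 < lam i) -> (forall i, psdmx (Q i)) -> pdmx (\sum_i Q i) ->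
  pdmx (\sum_i lam i *: Q i) -> 0 <= t <= 1 ->
  loewner_le (\sum_i lam i `^ t *: Q i)
             (geomean (\sum_i Q i) (\sum_i lam i *: Q i) t).
Proof.
move=> lam_gt0 Q_psd; set M := \sum_i Q i; set N := \sum_i _ => M_pd N_pd t01.
have [ST TS] := mxpow_halfK M_pd.
have SE := mxpow_half_sqr M_pd.
rewrite /geomean; set C := mxpow M (- 2^-1) *m N *m _.
have C_pd : pdmx C by exact: pdmx_sandwich.
have Str := mxpow_tr M_pd 2^-1; have Ttr := mxpow_tr M_pd (- 2^-1).
move: (mxpow M 2^-1) (mxpow M (- 2^-1)) ST TS SE Str Ttr @C C_pd.
move=> S T ST TS SE Str Ttr C C_pd.
pose E i := T *m Q i *m T.
have E_sum (c : I -> R) : \sum_i c i *: E i = T *m (\sum_i c i *: Q i) *m T.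
  rewrite mulmx_sumr mulmx_suml; apply: eq_bigr => i _.
  by rewrite -scalemxAr -scalemxAl.
have CE : C = \sum_i lam i *: E i by rewrite E_sum.
have E1 : \sum_i E i = 1%:M.
  rewrite -mulmx_suml -mulmx_sumr -/M -SE.
  by rewrite !mulmxA TS mul1mx ST.
have E_psd i : psdmx (E i).
  by rewrite /E -{1}Ttr; apply: psdmx_congr.
have := powR_sum_le lam_gt0 E_psd E1; rewrite -CE => /(_ _ C_pd t01) le.
have := psdmx_congr S le; rewrite Str mulmxBr mulmxBl E_sum.
by rewrite !mulmxA ST mul1mx -[X in _ - X]mulmxA TS mulmx1.
Qed.

End GeometricMean.

Theorem proposition14 (R : realType) (d m : nat)
    (Phi : {linear 'M[R]_d -> 'M[R]_d}) (B : 'M[R]_d) (f : 'M[R]_d -> 'M[R]_m)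
    (Phi_pos : positive_map Phi)
    (B_psd : psdmx B)
    (phi_pd : set_fun (@pdmx R d) (@pdmx R d) (fun X => Phi X + B))
    (f_pd : set_fun (@pdmx R d) (@pdmx R m) f)
    (f_cont : {within @pdmx R d, continuous f})
    (f_gconvex : gconvex f)
    (f_incr : loewner_increasing f) :
  gconvex (fun X => f (Phi X + B)).
Proof.
move=> X Y t X_pd Y_pd t01.
have phiX_pd := phi_pd _ X_pd; have phiY_pd := phi_pd _ Y_pd.
(* Write [phi X = Phi X + B]. Convexity of [f] along the geodesic from [phi X] to [phi Y] leaves the
   comparison of [phi] of the geodesic point with the geodesic point of the images, under [f]. *)
apply: loewner_le_trans (f_gconvex _ _ _ phiX_pd phiY_pd t01).
apply: f_incr; first exact/phi_pd/pdmx_geomean.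
  exact: pdmx_geomean.
have [lam [Q [lam_gt0 Q_psd XE YE ->]]] := geomean_decomposition X_pd Y_pd.
(* The additional index [ord0] carries [B] with weight 1. *)
pose lam' (i : 'I_d.+1) := oapp lam 1 (unlift ord0 i).
pose Q' (i : 'I_d.+1) := oapp (fun j => Phi (Q j)) B (unlift ord0 i).
(* The condition [g 1 = 1] keeps the coefficient of [B] equal to 1. It is applied to the constant 1,
   the identity and the power [t], for [X], [Y] and the geodesic point. *)
have phiE (g : R -> R) : g 1 = 1 ->
    Phi (\sum_i g (lam i) *: Q i) + B = \sum_i g (lam' i) *: Q' i.
  move=> g1; rewrite big_ord_recl /lam' /Q' unlift_none /= g1 scale1r addrC.
  rewrite linear_sum; congr (_ + _); apply: eq_bigr => i _.
  by rewrite liftK linearZ.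
have phiXE : Phi X + B = \sum_i Q' i.
  rewrite XE; transitivity (Phi (\sum_i (1 : R) *: Q i) + B).
    by congr (Phi _ + B); apply: eq_bigr => i _; rewrite scale1r.
  by rewrite (phiE (fun=> 1)) //; apply: eq_bigr => i _; rewrite scale1r.
have phiYE : Phi Y + B = \sum_i lam' i *: Q' i by rewrite YE (phiE id).
rewrite (phiE (fun x => x `^ t)) ?powR1 // phiXE phiYE.
apply: powR_sum_le_geomean => //; rewrite -?phiXE -?phiYE //.
- by move=> i; rewrite /lam'; case: unliftP => [j|] _ /=.
- by move=> i; rewrite /Q'; case: unliftP => [j|] _ //=; apply/Phi_pos/Q_psd.
Qed.
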